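(* Let $I\subset S=K[x_1,\dots,x_n]$ be a monomial ideal with $\operatorname{Ass}(S/I)=\{P_1,\dots,P_s\}$. Then $$\operatorname{sdepth}(I)\le \min\{\operatorname{sdepth}(P_i) : 1\le i\le s\}.$$
   Context: $K$ is a field and $S=K[x_1,\dots,x_n]$ is the polynomial ring, with its standard $\mathbb{Z}^n$-grading. Let $M$ be a finitely generated $\mathbb{Z}^n$-graded $S$-module. For a homogeneous $u\in M$ and a subset $Z\subset\{x_1,\dots,x_n\}$, $uK[Z]$ denotes the $K$-subspace of $M$ generated by all $uv$, $v$ a monomial in $K[Z]$; if $uK[Z]$ is a free $K[Z]$-module it is called a Stanley space of dimension $|Z|$. A Stanley decomposition of $M$ is a presentation of $M$ as a finite direct sum of $\mathbb{Z}^n$-graded $K$-vector spaces $\mathcal{D}: M=\bigoplus_{i=1}^{s}u_iK[Z_i]$ with each $u_iK[Z_i]$ a Stanley space; $\operatorname{sdepth}\mathcal{D}=\min_i|Z_i|$, and $\operatorname{sdepth} M$ (or $\operatorname{sdepth}_S M$) is the maximum of $\operatorname{sdepth}\mathcal{D}$ over all Stanley decompositions $\mathcal{D}$ of $M$. *)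

(* Defs.v *)
From mathcomp Require Import all_boot all_order all_algebra.
From mathcomp Require Import ring_quotient mpoly boolp.

Set Implicit Arguments.
Unset Strict Implicit.
Unset Printing Implicit Defensive.

Import GRing.Theory.
Local Open Scope ring_scope.

(* Ideals of S = {mpoly K[n]} are given by their membership predicate. *)

Definition monomial_ideal (K : fieldType) (n : nat)
    (I : {pred {mpoly K[n]}}) : Prop :=
  exists A : 'X_{1..n} -> Prop, forall f : {mpoly K[n]},
    f \in I <->
    exists (r : nat) (g : 'I_r -> {mpoly K[n]}) (m : 'I_r -> 'X_{1..n}),
      (forall j, A (m j)) /\ f = \sum_(j < r) g j * 'X_[m j].

(* The annihilator in S of the class of f in S/I. *)
Definition ann_class (K : fieldType) (n : nat)
    (I : {pred {mpoly K[n]}}) (f : {mpoly K[n]}) : {pred {mpoly K[n]}} :=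
  [pred g | g * f \in I].

(* P \in Ass(S/I).  idealr_closed includes that 1 is not in P. *)
Definition associated_prime (K : fieldType) (n : nat)
    (I P : {pred {mpoly K[n]}}) : Prop :=
  [/\ idealr_closed P, prime_idealr_closed P &
      exists f : {mpoly K[n]}, P =i ann_class I f].

(* f lies in the component of degree a of S for its standard Z^n-grading; this
   component is 0 when some a i is negative. *)
Definition in_degree (K : fieldType) (n : nat)
    (a : 'I_n -> int) (f : {mpoly K[n]}) : Prop :=
  forall m : 'X_{1..n}, m \in msupp f -> forall i : 'I_n, (m i)%:Z = a i.

Definition homogeneous (K : fieldType) (n : nat) (f : {mpoly K[n]}) : Prop :=
  exists a : 'I_n -> int, in_degree a f.

(* f \in K[Z], where Z is given by the indices of its variables. *)
Definition in_subpoly (K : fieldType) (n : nat)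
    (Z : {set 'I_n}) (f : {mpoly K[n]}) : Prop :=
  forall m : 'X_{1..n}, m \in msupp f ->
    forall i : 'I_n, i \notin Z -> m i = 0%N.

(* g \in uK[Z] *)
Definition in_span (K : fieldType) (n : nat)
    (u : {mpoly K[n]}) (Z : {set 'I_n}) (g : {mpoly K[n]}) : Prop :=
  exists2 v : {mpoly K[n]}, in_subpoly Z v & g = u * v.

(* uK[Z] is a Stanley space: u is homogeneous and uK[Z] is K[Z]-free on u. *)
Definition stanley_space (K : fieldType) (n : nat)
    (u : {mpoly K[n]}) (Z : {set 'I_n}) : Prop :=
  homogeneous u /\
  (forall v : {mpoly K[n]}, in_subpoly Z v -> u * v = 0 -> v = 0).

(* M is the internal direct sum of the Stanley spaces u_i K[Z_i]; it is one of
   Z^n-graded spaces because every u_i is homogeneous. *)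
Definition stanley_decomposition (K : fieldType) (n : nat)
    (M : {pred {mpoly K[n]}}) (s : nat)
    (u : 'I_s -> {mpoly K[n]}) (Z : 'I_s -> {set 'I_n}) : Prop :=
  [/\ forall i, u i \in M /\ stanley_space (u i) (Z i),
      forall g : {mpoly K[n]},
        g \in M <->
        exists h : 'I_s -> {mpoly K[n]},
          (forall i, in_span (u i) (Z i) (h i)) /\ g = \sum_(i < s) h i &
      forall h : 'I_s -> {mpoly K[n]},
        (forall i, in_span (u i) (Z i) (h i)) ->
        \sum_(i < s) h i = 0 -> forall i, h i = 0].

(* The default n of the minimum is an upper bound of all #|Z i|, so it only
   matters for the empty decomposition, i.e. for M = 0. *)
Definition sdepth_dec (n s : nat) (Z : 'I_s -> {set 'I_n}) : nat :=
  \big[minn/n]_(i < s) #|Z i|.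

(* All values sdepth_dec Z are at most n, hence the range of the maximum. *)
Definition sdepth (K : fieldType) (n : nat) (M : {pred {mpoly K[n]}}) : nat :=
  (\max_(d < n.+1 |
     `[< exists (s : nat) (u : 'I_s -> {mpoly K[n]}) (Z : 'I_s -> {set 'I_n}),
           stanley_decomposition M u Z /\ sdepth_dec Z = d >]) d)%N.

(* Main.v *)
Require Import Defs.
From mathcomp Require Import all_boot all_order all_algebra.
From mathcomp Require Import ring_quotient mpoly boolp.

(** Two facts give the bound.  First, every associated prime of S/I is a colon
    ideal (I : x^v) for a single monomial x^v ([associated_prime_colon]).
    Second, sdepth I <= sdepth (I : x^v) for every monomial x^v
    ([sdepth_colon]).

    For the second fact, everything is read off from exponents.  A monomial
    ideal is the span of the monomials with exponent in an upward closed set B,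
    and a Stanley space uK[Z] is the span of the monomials with exponent in a
    cone e + N^Z, since a homogeneous u <> 0 is a scalar times x^e.  A Stanley
    decomposition of I is therefore a partition of B into finitely many cones
    ([stanley_cone_partition], [cone_partition_stanley]).  The exponents of
    (I : x^v) form the translate B - v, and translating the cone e + N^Z by -v
    and cutting it by N^n yields either nothing or a cone with the same set Z
    ([cone_add]).  Hence (I : x^v) has a Stanley decomposition using only sets
    Z that already occur for I, and its minimal dimension can only go up.

    For the first fact, let P = ann(f mod I) where f has the least possible
    number of terms.  If x^a kills one term c x^v of f modulo I while x^a is
    not in P, then x^a (f - c x^v) still has annihilator P because P is prime,
    and it has fewer terms; so x^a must be in P.  Comparing leading terms in
    g f, this forces P to be spanned by monomials, and then P = (I : x^v) for
    the leading exponent v of f. *)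

Set Implicit Arguments.
Unset Strict Implicit.
Unset Printing Implicit Defensive.

Import GRing.Theory.
Local Open Scope ring_scope.

(** * Spans of monomials *)

Definition spanned_by (K : fieldType) (n : nat)
    (M : {pred {mpoly K[n]}}) (B : 'X_{1..n} -> Prop) : Prop :=
  forall g : {mpoly K[n]}, g \in M <-> forall m, m \in msupp g -> B m.

Definition upward_closed (n : nat) (B : 'X_{1..n} -> Prop) : Prop :=
  forall a m, B m -> B (a + m)%MM.

(** The exponents of the monomials of x^e K[Z]. *)
Definition cone (n : nat) (e : 'X_{1..n}) (Z : {set 'I_n}) :
    pred 'X_{1..n} :=
  fun m => [forall i, (e i <= m i)%N && ((i \notin Z) ==> (m i == e i))].

Definition cone_partition (n s : nat) (B : 'X_{1..n} -> Prop)
    (e : 'I_s -> 'X_{1..n}) (Z : 'I_s -> {set 'I_n}) : Prop :=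
  (forall m, B m <-> exists i, cone (e i) (Z i) m) /\
  (forall m i j, cone (e i) (Z i) m -> cone (e j) (Z j) m -> i = j).

Section MonomialSpaces.

Variables (K : fieldType) (n : nat).
Implicit Types (f g h : {mpoly K[n]}) (m a b e v : 'X_{1..n}).
Implicit Types (I P M : {pred {mpoly K[n]}}) (B : 'X_{1..n} -> Prop).

Lemma spanned_byX M B m : spanned_by M B -> 'X_[m] \in M <-> B m.
Proof.
move=> MB; split=> [/MB|Bm]; first by apply; rewrite msuppX mem_seq1.
by apply/MB => m'; rewrite msuppX mem_seq1 => /eqP ->.
Qed.

Lemma spanned_by0 M B : spanned_by M B -> 0 \in M.
Proof. by move=> MB; apply/MB=> m; rewrite mcoeff_msupp mcoeff0 eqxx. Qed.

Lemma spanned_byD M B f g :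
  spanned_by M B -> f \in M -> g \in M -> f + g \in M.
Proof.
move=> MB /MB fM /MB gM; apply/MB=> m /msuppD_le.
by rewrite mem_cat => /orP[/fM|/gM].
Qed.

Lemma spanned_byM M B f g :
  spanned_by M B -> upward_closed B -> f \in M -> g * f \in M.
Proof.
move=> MB upB /MB fM; apply/MB=> m /msuppM_le/allpairsP[[a b] /= [_ bf ->]].
exact/upB/fM.
Qed.

(** B consists of the multiples of the generators: a term of a combination of
    generators is a multiple of one of them, and conversely a polynomial is
    rebuilt term by term, choosing a generator for each term. *)
Lemma monomial_ideal_spanned I :
  monomial_ideal I -> exists2 B, upward_closed B & spanned_by I B.
Proof.
case=> A IA; exists (fun m => exists2 a, A a & (a <= m)%MM).
  move=> b m [a Aa le_am]; exists a => //; apply: lepm_trans le_am _.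
  exact: lem_addl.
move=> g; split=> [/IA[r [c [a [Aa ->]]]] m /msupp_sum_le|gA].
  case/flattenP=> _ /mapP[j _ ->].
  rewrite (perm_mem (msuppMX _ _)) => /mapP[b _ ->].
  by exists (a j) => //; exact: lem_addr.
have /choice[w wP] m : exists a, m \in msupp g -> A a /\ (a <= m)%MM.
  case: (boolP (m \in msupp g)) => [/gA[a Aa am]|_]; last by exists m.
  by exists a.
have mem (j : 'I_(size (msupp g))) : nth 0%MM (msupp g) j \in msupp g.
  exact: mem_nth.
apply/IA; exists (size (msupp g)).
exists (fun j => let m := nth 0%MM (msupp g) j in g@_m *: 'X_[m - w m]).
exists (fun j => w (nth 0%MM (msupp g) j)).
split=> [j|]; first by case: (wP _ (mem j)).
rewrite {1}[g]mpolyE (big_nth 0%MM) big_mkord; apply: eq_bigr => j _ /=.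
by rewrite -scalerAl -mpolyXD submK //; case: (wP _ (mem j)).
Qed.

(** * Associated primes are colon ideals by monomials *)

Lemma idealr_closed_terms P g (Q : pred 'X_{1..n}) :
  idealr_closed P -> (forall m, m \in msupp g -> Q m -> 'X_[m] \in P) ->
  \sum_(m <- msupp g | Q m) g@_m *: 'X_[m] \in P.
Proof.
case=> P0 _ Pc gP; rewrite big_seq_cond.
elim/big_rec: _ => // m f /andP[mg Qm] fP.
by rewrite -mul_mpolyC; apply: Pc => //; exact: gP.
Qed.

Lemma minimal_annihilated I P f0 :
  P =i ann_class I f0 ->
  exists2 f, P =i ann_class I f &
    forall f', P =i ann_class I f' -> (size (msupp f) <= size (msupp f'))%N.
Proof.
move=> Pf0.
pose good k := `[< exists2 f, P =i ann_class I f & size (msupp f) = k >].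
have : exists k, good k by exists (size (msupp f0)); apply/asboolP; exists f0.
case/ex_minnP => k /asboolP[f Pf <-] kmin; exists f => // f' Pf'.
by apply: kmin; apply/asboolP; exists f'.
Qed.

(** The classical fact that associated primes of a graded module are
    annihilators of homogeneous elements.  The minimality of f is used twice:
    it makes every monomial that kills some term of f an element of P, first to
    show that P is spanned by monomials, then to compare P with the annihilator
    of the leading term of f. *)
Lemma associated_prime_colon I P B :
  upward_closed B -> spanned_by I B -> associated_prime I P ->
  exists v, spanned_by P (fun m => B (m + v)%MM).
Proof.
move=> upB IB [Pid Pprime [f0 /minimal_annihilated[f Pf fmin]]].
have [P0 P1 Pc] := Pid.
have annP g : (g \in P) = (g * f \in I) by rewrite Pf inE.
have f_neq0 : f != 0.
  apply: contra P1 => /eqP f0E.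
  by rewrite annP f0E mulr0; exact: spanned_by0 IB.
(* Otherwise P is also the annihilator of x^a (f - f_v x^v), which has fewer
   terms than f. *)
have key v a : v \in msupp f -> B (a + v)%MM -> 'X_[a] \in P.
  move=> vf Bav; apply: contraT => aP.
  pose f' := (f - f@_v *: 'X_[v]) * 'X_[a].
  have lt_f' : (size (msupp f') < size (msupp f))%N.
    rewrite (perm_size (msuppMX _ _)) size_map (perm_size (msupp_rem _ _)).
    by rewrite size_rem // ltn_predL; case: (msupp f) vf.
  have annf' : P =i ann_class I f'.
    move=> g; rewrite inE.
    have vaI c : c * (f@_v *: 'X_[a + v]) \in I.
      apply: (spanned_byM _ IB upB); rewrite -mul_mpolyC.
      exact/(spanned_byM _ IB upB)/(spanned_byX _ IB).
    have eq_gf' : g * 'X_[a] * f = g * f' + g * (f@_v *: 'X_[a + v]).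
      rewrite /f' mulrBl -scalerAl -mpolyXD [(v + a)%MM]addmC mulrBr subrK.
      by rewrite -mulrA (mulrC f).
    have -> : (g * f' \in I) = (g * 'X_[a] \in P).
      rewrite annP; apply/idP/idP=> [gf'I|gXfI].
        rewrite eq_gf'; exact: (spanned_byD IB gf'I (vaI g)).
      rewrite -[g * f'](addrK (g * (f@_v *: 'X_[a + v]))) -eq_gf' -mulNr.
      exact: (spanned_byD IB gXfI (vaI (- g))).
    apply/idP/idP=> [gP|/Pprime]; last by rewrite (negbTE aP) orbF.
    by rewrite mulrC -[_ * g]addr0; apply: Pc.
  by have := fmin f' annf'; rewrite leqNgt lt_f'.
(* The part g2 of g made of its terms outside P lies in P, since the rest g1
   does; a leading term of g2 would contradict [key] at the leading term of f. *)
have terms g b : g \in P -> b \in msupp g -> 'X_[b] \in P.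
  move=> gP bg; apply: contraT => bP.
  pose g1 := \sum_(m <- msupp g | 'X_[m] \in P) g@_m *: 'X_[m].
  pose g2 := \sum_(m <- msupp g | 'X_[m] \notin P) g@_m *: 'X_[m].
  have gE : g = g1 + g2 by rewrite {1}[g]mpolyE (bigID (fun m => 'X_[m] \in P)).
  have g2P : g2 \in P.
    rewrite -[g2](addKr g1) -gE -mulN1r.
    by apply: Pc => //; apply: idealr_closed_terms.
  have g2supp m : (m \in msupp g2) = (m \in msupp g) && ('X_[m] \notin P).
    rewrite /g2 -big_filter (perm_mem (msupp_sumX _ _)) ?filter_uniq //.
      by rewrite mem_filter andbC.
    by move=> c; rewrite mem_filter -mcoeff_msupp => /andP[].
  have g2_neq0 : g2 != 0.
    apply: contraTneq bg => g20.
    by have := g2supp b; rewrite bP andbT => <-; rewrite g20 msupp0.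
  have := mlead_supp g2_neq0; rewrite g2supp => /andP[_ /negP[]].
  apply: (key (mlead f)); first exact: mlead_supp.
  move: g2P; rewrite annP => /IB; apply.
  by rewrite -mleadM // mlead_supp // mulf_neq0.
exists (mlead f) => g; split=> [gP b bg|gB].
  have : 'X_[b] * f \in I by rewrite -annP; exact: terms bg.
  move/IB; apply; rewrite mulrC (perm_mem (msuppMX _ _)).
  by rewrite map_f // mlead_supp.
rewrite [g]mpolyE; apply: idealr_closed_terms => // m mg _.
exact: key (mlead_supp f_neq0) (gB _ mg).
Qed.

(** * Stanley decompositions as partitions into cones *)

Lemma in_span_cone (c : K) e (Z : {set 'I_n}) g : c != 0 ->
  in_span (c *: 'X_[e]) Z g <-> forall m, m \in msupp g -> cone e Z m.
Proof.
move=> c0; split=> [[v vZ ->] m|gC].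
  rewrite -scalerAl mulrC (perm_mem (msuppZ _ c0)) (perm_mem (msuppMX _ _)).
  case/mapP=> a av ->; apply/forallP=> i; rewrite mnmDE leq_addr /=.
  by apply/implyP=> iZ; rewrite (vZ _ av) ?addn0.
have le_e m : m \in msupp g -> (e <= m)%MM.
  by move/gC/forallP=> gm; apply/mnm_lepP=> i; case/andP: (gm i).
exists (\sum_(m <- msupp g) (c^-1 * g@_m) *: 'X_[m - e]).
  move=> a /msupp_sum_le/flattenP[_ /mapP[m + ->]]; rewrite mem_filter /= => mg.
  move/msuppZ_le; rewrite msuppX mem_seq1 => /eqP-> i iZ; rewrite mnmBE.
  by have /forallP/(_ i)/andP[_] := gC _ mg; rewrite iZ => /eqP->; rewrite subnn.
rewrite mulr_sumr {1}[g]mpolyE !big_seq; apply: eq_bigr => m mg.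
by rewrite -scalerAl -scalerAr -mpolyXD scalerA mulVKf // addmC submK ?le_e.
Qed.

(** Freeness, tested on the polynomial 1 of K[Z], gives u <> 0; all exponents of
    u equal its degree, so u has a single term. *)
Lemma stanley_space_term (u : {mpoly K[n]}) (Z : {set 'I_n}) :
  stanley_space u Z -> exists2 c : K, c != 0 & exists e, u = c *: 'X_[e].
Proof.
case=> -[d ud] uZ.
have u0 : u != 0.
  apply/eqP=> u0; suff /eqP : 1 = 0 :> {mpoly K[n]} by rewrite oner_eq0.
  apply: uZ; last by rewrite u0 mul0r.
  by move=> m; rewrite msupp1 mem_seq1 => /eqP-> i _; rewrite mnm0E.
exists (mleadc u); first by rewrite mleadc_eq0.
exists (mlead u); rewrite {1}[u]mpolyE.
rewrite (bigD1_seq (mlead u)) ?msupp_uniq ?mlead_supp //= big_seq_cond big1.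
  by rewrite addr0.
move=> m /andP[mu /eqP[]]; apply/mnmP=> i.
by have := ud _ mu i; rewrite -(ud _ (mlead_supp u0) i) => -[].
Qed.

(** A monomial x^m of M is a sum of elements of the Stanley spaces, so it is a
    term of one of the summands; if x^m lay in two Stanley spaces, x^m and -x^m
    would be a nontrivial decomposition of 0. *)
Lemma stanley_cone_partition M B s (u : 'I_s -> {mpoly K[n]}) Z :
  spanned_by M B -> stanley_decomposition M u Z ->
  exists e : 'I_s -> 'X_{1..n}, cone_partition B e Z.
Proof.
move=> MB [uS Mu dirZ].
have /choice[w wP] i :
    exists w : K * 'X_{1..n}, w.1 != 0 /\ u i = w.1 *: 'X_[w.2].
  by have [c c0 [e ue]] := stanley_space_term (uS i).2; exists (c, e).
have spanE i g : in_span (u i) (Z i) g <->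
    forall m, m \in msupp g -> cone (w i).2 (Z i) m.
  by have [c0 ->] := wP i; apply: in_span_cone.
have spanX i c m : cone (w i).2 (Z i) m -> in_span (u i) (Z i) (c *: 'X_[m]).
  by move=> im; apply/spanE=> b /msuppZ_le; rewrite msuppX mem_seq1 => /eqP->.
have span0 i : in_span (u i) (Z i) 0.
  by apply/spanE=> m; rewrite msupp0.
exists (fun i => (w i).2); split=> [m|m i j im jm].
  split=> [/(spanned_byX _ MB)/Mu[h [hZ mh]]|[i im]].
    have : m \in msupp ('X_[m] : {mpoly K[n]}) by rewrite msuppX mem_seq1.
    rewrite mh => /msupp_sum_le/flattenP[_ /mapP[i _ ->]] hm.
    by exists i; have /spanE := hZ i; apply.
  apply/(spanned_byX _ MB)/Mu.
  exists (fun j => if j == i then 'X_[m] else 0); split=> [j|].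
    by case: eqP => // ->; rewrite -['X_[m]]scale1r; apply: spanX.
  by rewrite -big_mkcond big_pred1_eq.
apply: contrapT => ij.
pose h k : {mpoly K[n]} :=
  if k == i then 1 *: 'X_[m] else if k == j then (-1) *: 'X_[m] else 0.
have hZ k : in_span (u k) (Z k) (h k).
  by rewrite /h; case: eqP => [->|_]; [|case: eqP => [->|_] //]; apply: spanX.
have sum_h : \sum_(k < s) h k = 0.
  have ji : j != i by apply/eqP=> ji; case: ij.
  rewrite (bigD1 i) //= (bigD1 j) //= big1 => [|k /andP[/negbTE ki /negbTE kj]].
    by rewrite /h !eqxx (negbTE ji) addr0 -scalerDl subrr scale0r.
  by rewrite /h ki kj.
have /eqP := dirZ h hZ sum_h i.
by rewrite /h eqxx scale1r -msupp_eq0 msuppX.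
Qed.

(** Each polynomial splits by grouping its terms according to the cone that
    contains their exponent; summands from disjoint cones have no common term,
    so they cannot cancel. *)
Lemma cone_partition_stanley M B s (e : 'I_s -> 'X_{1..n})
    (Z : 'I_s -> {set 'I_n}) :
  spanned_by M B -> cone_partition B e Z ->
  stanley_decomposition M (fun i => 'X_[e i]) Z.
Proof.
move=> MB [Be dis].
have spanE i g :
    in_span 'X_[e i] (Z i) g <->
    forall m, m \in msupp g -> cone (e i) (Z i) m.
  by rewrite -[X in in_span X]scale1r; apply: in_span_cone; exact: oner_neq0.
split=> [i|g|h hZ h0 i].
- split.
    apply/(spanned_byX _ MB)/Be; exists i; apply/forallP=> j.
    by rewrite leqnn eqxx implybT.
  split.
    exists (fun j => (e i j)%:Z) => m; rewrite msuppX mem_seq1.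
    by move/eqP->.
  by move=> v _ /eqP; rewrite mulf_eq0 -msupp_eq0 msuppX => /eqP.
- split=> [gM|[h [hZ ->]]].
    exists (fun i => \sum_(m <- msupp g | cone (e i) (Z i) m) g@_m *: 'X_[m]).
    split=> [i|].
      apply/spanE=> m /msupp_sum_le/flattenP[_ /mapP[a + ->]].
      rewrite mem_filter => /andP[ca _] /msuppZ_le.
      by rewrite msuppX mem_seq1 => /eqP->.
    rewrite {1}[g]mpolyE; under [RHS]eq_bigr do rewrite big_mkcond.
    rewrite exchange_big /= !big_seq; apply: eq_bigr => m mg.
    have [i im] := (Be m).1 ((MB g).1 gM m mg).
    rewrite (bigD1 i) //= im big1 ?addr0 // => j /eqP ji.
    by case: ifP => // jm; case: ji; apply: dis jm im.
  apply/MB=> m /msupp_sum_le/flattenP[_ /mapP[i _ ->]] hm.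
  by apply/Be; exists i; have /spanE := hZ i; apply.
apply/mpolyP=> m; rewrite mcoeff0; apply/eqP; apply: contraT => him.
have := congr1 (mcoeff m) h0; rewrite raddf_sum mcoeff0 (bigD1 i) //= big1.
  by rewrite addr0 => him0; rewrite him0 eqxx in him.
move=> j /eqP ji; apply: memN_msupp_eq0; apply/negP=> hjm; case: ji.
apply: (dis m); first exact: (spanE _ _).1 (hZ j) _ hjm.
by apply: ((spanE _ _).1 (hZ i)); rewrite mcoeff_msupp.
Qed.

(** * Translation of cones and comparison of Stanley depths *)

(** The subtraction e - v is truncated, so e - v is the exponent of
    lcm(x^e, x^v) / x^v.  Outside Z the exponents of the cone are frozen at e,
    whence the condition v i <= e i there. *)
Lemma cone_add e (Z : {set 'I_n}) v m :
  cone e Z (m + v)%MM =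
  [forall i, (i \notin Z) ==> (v i <= e i)%N] && cone (e - v)%MM Z m.
Proof.
apply/forallP/andP=> [emv|[/forallP ve /forallP em] i].
  split; apply/forallP=> i; have := emv i; rewrite mnmDE ?mnmBE => /andP[le_e].
    by case: (i \in Z) => //= /eqP <-; exact: leq_addl.
  rewrite leq_subLR (addnC (v i)) le_e.
  by case: (i \in Z) => //= /eqP <-; rewrite addnK.
have := em i; have := ve i; rewrite mnmDE mnmBE leq_subLR (addnC (v i)).
by case: (i \in Z) => //= le_ve /andP[-> /eqP->]; rewrite subnK ?eqxx.
Qed.

(** The nonempty translates are those of the cones indexed by G; keeping k,
    which tells where each new cone comes from, makes the sets Z comparable. *)
Lemma cone_partition_colon s B (e : 'I_s -> 'X_{1..n})
    (Z : 'I_s -> {set 'I_n}) v :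
  cone_partition B e Z ->
  exists (t : nat) (e' : 'I_t -> 'X_{1..n}) (k : 'I_t -> 'I_s),
    cone_partition (fun m => B (m + v)%MM) e' (Z \o k).
Proof.
case=> Be dis.
pose G := [set i | [forall j, (j \notin Z i) ==> (v j <= e i j)%N]].
exists #|G|, (fun k => e (enum_val k) - v)%MM, (fun k => enum_val k).
have coneE (k : 'I_#|G|) m :
    cone (e (enum_val k) - v)%MM (Z (enum_val k)) m =
    cone (e (enum_val k)) (Z (enum_val k)) (m + v)%MM.
  by rewrite cone_add; have := enum_valP k; rewrite inE => ->.
split=> [m|m k l /=]; last first.
  by rewrite !coneE => km lm; apply: enum_val_inj; apply: dis km lm.
split=> [/Be[i im]|[k /=]]; last first.
  by rewrite coneE => km; apply/Be; exists (enum_val k).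
have iG : i \in G by rewrite inE; move: im; rewrite cone_add => /andP[].
by exists (enum_rank_in iG i); rewrite /= coneE enum_rankK_in.
Qed.

End MonomialSpaces.

Lemma sdepth_dec_le n s (Z : 'I_s -> {set 'I_n}) : (sdepth_dec Z <= n)%N.
Proof.
rewrite /sdepth_dec; elim/big_rec: _ => // i m _ le_mn.
by rewrite (leq_trans (geq_minr _ _)).
Qed.

Lemma sdepth_dec_le_card n s (Z : 'I_s -> {set 'I_n}) i :
  (sdepth_dec Z <= #|Z i|)%N.
Proof.
rewrite /sdepth_dec; move: (mem_index_enum i); elim: (index_enum _) => // j r IHr.
rewrite in_cons big_cons => /predU1P[<-|/IHr]; first exact: geq_minl.
exact: leq_trans (geq_minr _ _).
Qed.

Lemma sdepth_dec_comp n s t (Z : 'I_s -> {set 'I_n}) (k : 'I_t -> 'I_s) :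
  (sdepth_dec Z <= sdepth_dec (Z \o k))%N.
Proof.
rewrite {2}/sdepth_dec; elim/big_rec: _ => [|i m _ le_m].
  exact: sdepth_dec_le.
by rewrite leq_min le_m sdepth_dec_le_card.
Qed.

(** The spanning condition on P says that P = (I : x^v). *)
Lemma sdepth_colon (K : fieldType) n (I P : {pred {mpoly K[n]}}) B v :
  spanned_by I B -> spanned_by P (fun m => B (m + v)%MM) ->
  (sdepth I <= sdepth P)%N.
Proof.
move=> IB PB; apply/bigmax_leqP=> d /asboolP[s [u [Z [uZ <-]]]].
have [e eZ] := stanley_cone_partition IB uZ.
have [t [e' [k e'Z]]] := cone_partition_colon v eZ.
apply: leq_trans (sdepth_dec_comp Z k) _.
have ltn : (sdepth_dec (Z \o k) < n.+1)%N by exact: sdepth_dec_le.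
apply: (@leq_bigmax_cond _ _ (fun d : 'I_n.+1 => d : nat) (Ordinal ltn)).
apply/asboolP; exists t, (fun i => 'X_[e' i]), (Z \o k); split=> //.
exact: cone_partition_stanley PB e'Z.
Qed.

Theorem theorem1p1 (K : fieldType) (n : nat) (I : {pred {mpoly K[n]}})
    (hI : monomial_ideal I) (s : nat) (P : 'I_s -> {pred {mpoly K[n]}})
    (hP : forall Q : {pred {mpoly K[n]}},
        associated_prime I Q <-> exists i : 'I_s, Q =i P i) :
  (sdepth I <= \big[minn/n]_(i < s) sdepth (P i))%N.
Proof.
have [B upB IB] := monomial_ideal_spanned hI.
elim/big_rec: _ => [|i m _ le_m].
  by apply/bigmax_leqP=> d _; rewrite -ltnS.
have assP : associated_prime I (P i) by apply/hP; exists i.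
have [v PB] := associated_prime_colon upB IB assP.
by rewrite leq_min le_m (sdepth_colon IB PB).
Qed.
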